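(* If a topological group $(G,\tau)$ is $\tau_p$-representable in $X$ and $Y$ is a $G$-extension of $X$, then $(G,\tau)$ is $\tau_p$-representable in $Y$. Moreover, $\tau$ is the least admissible group topology for the action $G\curvearrowright Y$.
   Context: All spaces are Tychonoff; actions are effective. An equiuniformity on a $G$-space $X$ is a uniformity $\mathcal U$ inducing the topology of $X$ such that every $g\in G$ is uniformly continuous and for every uniform cover $u\in\mathcal U$ there are a neighbourhood $O$ of $e\in G$ and $v\in\mathcal U$ such that $\{OV\mid V\in v\}$ refines $u$. $X$ is $G$-Tychonoff if it has an equiuniformity. If $\mathcal U$ is an equiuniformity on $X$, the action extends to a continuous action on the completion $\tilde X$ of $(X,\mathcal U)$, $\tilde X$ is a $G$-Tychonoff space and $X$ is a dense invariant subset of it; such a $\tilde X$ is called a $G$-extension of $X$. A group $G$ is representable in $X$ if it is a subgroup of the homeomorphism group of $X$. The topology of pointwise convergence $\tau_p$ on $G$ has as subbase the sets $[x,O]=\{g\in G\mid gx\in O\}$, $x\in X$, $O$ open in $X$. A topological group $(G,\tau)$ is $\tau_p$-representable in $X$ if $G$ is representable in $X$, $\tau=\tau_p$, and $X$ is a $G$-Tychonoff space under the natural action of $(G,\tau)$. The representation of $G$ in $Y$ is by the extended action. An admissible group topology on $G$ for an action of $G$ on $Y$ is a group topology $\sigma$ on $G$ such that the action $(G,\sigma)\times Y\to Y$ is continuous. Topologies are ordered by inclusion (least = coarsest). *)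

(* Defs.v *)
From HB Require Import structures.
From mathcomp Require Import all_boot all_order all_algebra.
From mathcomp Require Import all_classical reals topology urysohn.

Set Implicit Arguments.
Unset Strict Implicit.
Unset Printing Implicit Defensive.

Local Open Scope classical_set_scope.

(* Several topologies on one group (tau, tau_p, sigma) and several uniformities
   on one space have to be compared, so they are passed as explicit structures;
   [space tau] is [T] with the topology [tau], [uspace U] is [X] with the
   uniformity [U], which is required to induce the topology of [X]. *)
Record topology (T : Type) := Topology {
  opens : set_system T;
  opens_setT : opens setT;
  opens_setI : setI_closed opens;
  opens_bigcup : forall (I : Type) (f : I -> set T),
    (forall i, opens (f i)) -> opens (\bigcup_i f i)
}.

Definition space (T : Type) (tau : topology T) : Type := T.
HB.instance Definition _ (T : choiceType) (tau : topology T) :=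
  Choice.on (space tau).
HB.instance Definition _ (T : choiceType) (tau : topology T) :=
  isOpenTopological.Build (space tau)
    (opens_setT tau) (@opens_setI _ tau) (@opens_bigcup _ tau).

Record uniformity (X : topologicalType) := Uniformity {
  entourages : set_system (X * X);
  entourages_filter : Filter entourages;
  entourages_diagonal : forall A, entourages A -> diagonal `<=` A;
  entourages_inv : forall A, entourages A -> entourages (A^-1)%relation;
  entourages_split : forall A, entourages A ->
    exists2 B, entourages B & (B \; B)%relation `<=` A;
  entourages_nbhs : @nbhs X X = nbhs_ entourages
}.

Definition uspace (X : topologicalType) (U : uniformity X) : Type := X.
HB.instance Definition _ (X : topologicalType) (U : uniformity X) :=
  Topological.on (uspace U).
HB.instance Definition _ (X : topologicalType) (U : uniformity X) :=
  Nbhs_isUniform_mixin.Build (uspace U) (entourages_filter U)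
    (@entourages_diagonal _ U) (@entourages_inv _ U)
    (@entourages_split _ U) (entourages_nbhs U).

Definition tychonoff_space (T : topologicalType) : Prop :=
  hausdorff_space T /\ completely_regular_space T.

Definition homeomorphism (X : topologicalType) (f : X -> X) : Prop :=
  exists h : X -> X, [/\ continuous f, continuous h, cancel f h & cancel h f].

Definition group_topology (G : groupType) (tau : topology G) : Prop :=
  continuous (fun p : space tau * space tau => (p.1 * p.2)%g : space tau) /\
  continuous (fun g : space tau => (g^-1)%g : space tau).

Definition topological_group (G : groupType) (tau : topology G) : Prop :=
  group_topology tau /\ tychonoff_space (space tau).

Definition is_action (G : groupType) (X : Type) (act : G -> X -> X) : Prop :=
  (forall x, act 1%g x = x) /\
  (forall g h x, act (g * h)%g x = act g (act h x)).

Definition effective (G : groupType) (X : Type) (act : G -> X -> X) : Prop :=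
  forall g, (forall x, act g x = x) -> g = 1%g.

Definition continuous_action (G : groupType) (tau : topology G)
    (X : topologicalType) (act : G -> X -> X) : Prop :=
  is_action act /\ continuous (fun p : space tau * X => act p.1 p.2).

Definition G_space (G : groupType) (tau : topology G)
    (X : topologicalType) (act : G -> X -> X) : Prop :=
  [/\ tychonoff_space X, effective act & continuous_action tau act].

(* The covers that belong to the covering uniformity corresponding to the
   entourages of [X]. *)
Definition uniform_cover (X : uniformType) (u : set_system X) : Prop :=
  exists2 E : set (X * X), entourage E &
    forall x, exists2 A, u A & xsection E x `<=` A.

Definition refines (X : Type) (v u : set_system X) : Prop :=
  forall B, v B -> exists2 A, u A & B `<=` A.

Definition equiuniformity (G : groupType) (tau : topology G)
    (X : topologicalType) (act : G -> X -> X) (U : uniformity X) : Prop :=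
  (forall g, unif_continuous (act g : uspace U -> uspace U)) /\
  (forall u : set_system (uspace U), uniform_cover u ->
    exists O : set (space tau), exists v : set_system (uspace U),
      [/\ nbhs (1%g : space tau) O, uniform_cover v &
          refines [set [set act g x | g in O & x in V] | V in v] u]).

Definition G_Tychonoff (G : groupType) (tau : topology G)
    (X : topologicalType) (act : G -> X -> X) : Prop :=
  G_space tau act /\ exists U : uniformity X, equiuniformity tau act U.

(* [i : X -> Y] exhibits [Y] as the Hausdorff completion of [X]. The library's
   [completeType] is not used because it requires a base point. *)
Definition is_completion (X Y : uniformType) (i : X -> Y) : Prop :=
  [/\ injective i,
      @entourage X = @initial_ent X Y i,
      dense (range i),
      hausdorff_space Y &
      forall F : set_system Y, ProperFilter F -> cauchy F ->
        exists y : Y, F --> y].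

(* [Y], with the action [actY], is the completion of [X] with respect to some
   equiuniformity, [i] being the inclusion of [X] in [Y]. *)
Definition G_extension (G : groupType) (tau : topology G)
    (X : topologicalType) (act : G -> X -> X)
    (Y : topologicalType) (actY : G -> Y -> Y) (i : X -> Y) : Prop :=
  exists U : uniformity X, exists V : uniformity Y,
    [/\ equiuniformity tau act U,
        is_completion (i : uspace U -> uspace V),
        continuous_action tau actY &
        forall g x, i (act g x) = actY g (i x)].

(* An effective action by homeomorphisms is the same as an identification of
   [G] with a subgroup of the homeomorphism group of [X]. *)
Definition representable (G : groupType) (X : topologicalType)
    (act : G -> X -> X) : Prop :=
  [/\ is_action act, effective act & forall g, homeomorphism (act g)].

(* The index type of [isSubBaseTopological] must be pointed, which [X] need not
   be; so the subbase [x,O] is indexed by its own members. *)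
Definition taup_space (G : groupType) (X : topologicalType)
  (act : G -> X -> X) : Type := G.
HB.instance Definition _ (G : groupType) (X : topologicalType)
  (act : G -> X -> X) := Choice.on (taup_space act).
HB.instance Definition _ (G : groupType) (X : topologicalType)
    (act : G -> X -> X) :=
  @isSubBaseTopological.Build (taup_space act) (set G)
    [set [set g | O (act g x)] | x in [set: X] & O in open] id.

Definition taup_opens (G : groupType) (X : topologicalType)
  (act : G -> X -> X) : set_system G := @open (taup_space act).

Definition taup_representable (G : groupType) (tau : topology G)
    (X : topologicalType) (act : G -> X -> X) : Prop :=
  [/\ representable act, opens tau = taup_opens act & G_Tychonoff tau act].

Definition admissible_group_topology (G : groupType) (X : topologicalType)
    (act : G -> X -> X) (sigma : topology G) : Prop :=
  group_topology sigma /\ continuous_action sigma act.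

(* Main.v *)
(* A subbasic set [x,O] of X is the subbasic set [i x,O'] of Y, where O is the
   trace of O' on X; so tau_p for X is coarser than tau_p for Y. Conversely, any
   topology that makes the action on Y continuous contains all [y,O], hence
   tau_p for Y; this gives both tau = tau_p for Y and the minimality of tau.
   The uniformity of the completion Y is an equiuniformity because the relevant
   estimates hold on the dense subset X and pass to Y by continuity. *)
Require Import Defs.
From mathcomp Require Import all_boot all_order all_algebra.
From mathcomp Require Import all_classical reals topology urysohn.

Set Implicit Arguments.
Unset Strict Implicit.
Unset Printing Implicit Defensive.

Local Open Scope classical_set_scope.

Lemma taup_opens_subbase (G : groupType) (X : topologicalType)
    (act : G -> X -> X) (x : X) (O : set X) :
  open O -> taup_opens act [set g | O (act g x)].
Proof.
move=> oO; exists [set [set g | O (act g x)]]; last by rewrite bigcup_set1.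
by move=> _ ->; apply: (@finI_from1 _ _ _ id); exists x => //; exists O.
Qed.

(** An open set of [taup_space] is a union of finite intersections of subbasic sets, and [sigma] is
    closed under both operations. *)
Lemma taup_opens_min (G : groupType) (X : topologicalType)
    (act : G -> X -> X) (sigma : topology G) :
  (forall x O, open O -> opens sigma [set g | O (act g x)]) ->
  taup_opens act `<=` opens sigma.
Proof.
move=> sub _ [D' D'fin <-].
suff : @open (Defs.space sigma) (\bigcup_(A in D') A) by [].
apply: bigcup_open => A /D'fin [F FS <-].
rewrite bigcap_fset big_seq; apply: (big_ind (@open (Defs.space sigma))).
- exact: openT.
- by move=> ? ?; exact: openI.
- by move=> B /FS; rewrite inE => -[x _ [O oO <-]]; exact: sub.
Qed.

Lemma continuous_pairl (S T U : topologicalType) (f : S * T -> U) (t : T) :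
  continuous f -> continuous (fun s => f (s, t)).
Proof.
move=> ctf s; apply: (@continuous_comp _ _ _ (pair^~ t) f); last exact: ctf.
by apply: cvg_pair => //; exact: cvg_cst.
Qed.

Lemma continuous_pairr (S T U : topologicalType) (f : S * T -> U) (s : S) :
  continuous f -> continuous (fun t => f (s, t)).
Proof.
move=> ctf t; apply: (@continuous_comp _ _ _ (pair s) f); last exact: ctf.
by apply: cvg_pair => //; exact: cvg_cst.
Qed.

(** The set is the preimage of [O] under the orbit map of [y], which is continuous for [sigma]. *)
Lemma continuous_action_orbit_open (G : groupType) (sigma : topology G)
    (Y : topologicalType) (act : G -> Y -> Y) (y : Y) (O : set Y) :
  continuous_action sigma act -> open O -> opens sigma [set g | O (act g y)].
Proof.
move=> [_ /(@continuous_pairl _ _ _ _ y)/continuousP act_y] oO.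
exact: (act_y O oO).
Qed.

Lemma continuous_action_continuous (G : groupType) (sigma : topology G)
    (Y : topologicalType) (act : G -> Y -> Y) (g : G) :
  continuous_action sigma act -> continuous (act g).
Proof. by move=> [_ /(@continuous_pairr _ _ _ _ (g : Defs.space sigma))]. Qed.

Lemma continuous_action_homeomorphism (G : groupType) (sigma : topology G)
    (Y : topologicalType) (act : G -> Y -> Y) (g : G) :
  continuous_action sigma act -> homeomorphism (act g).
Proof.
move=> cact; have [[act1 actM] _] := cact.
exists (act (g^-1)%g); split.
- exact: continuous_action_continuous cact.
- exact: continuous_action_continuous cact.
- by move=> y; rewrite -actM mulVg act1.
- by move=> y; rewrite -actM mulgV act1.
Qed.

(* [uniform_completely_regular] cannot be used: it asks for a [realType]. *)
Lemma uniformity_completely_regular (Y : topologicalType) (V : uniformity Y) :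
  completely_regular_space Y.
Proof.
move=> x B clB nBx.
have : nbhs (x : uspace V) (~` B).
  by apply: open_nbhs_nbhs; split=> //; exact: closed_openC.
rewrite -nbhs_entourageE => -[E entE EB].
(* The separating uniformity is [V] itself: it induces the topology of [Y], and the section of [E]
   at [x] misses [B]. *)
exists (Uniform.class (uspace V)), E; split => //; last by move=> ?.
rewrite -subset0 => -[_ z] [[/= -> Bz] Exz].
by have /xsectionP/EB := Exz.
Qed.

Lemma dense_nbhs (T : topologicalType) (S : set T) (y : T) (N : set T) :
  dense S -> nbhs y N -> exists2 x, S x & N x.
Proof.
rewrite nbhsE => dS [O [oO Oy] ON].
by have [x [Ox Sx]] := dS O (ex_intro _ y Oy) oO; exists x => //; exact: ON.
Qed.

(* [A (x, x')] implies [C (F x, H x')] on a dense subset; approximating both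
   points of a pair by the dense subset costs two halvings of [A] and [C]. *)
Lemma entourage_dense_extension (X Y : uniformType) (i : X -> Y)
    (A C : set (Y * Y)) (F H : Y -> Y) :
  dense (range i) -> entourage A -> entourage C ->
  continuous F -> continuous H ->
  (forall x x', A (i x, i x') ->
    split_ent (split_ent C) (F (i x), H (i x'))) ->
  forall y y', split_ent (split_ent A) (y, y') -> C (F y, H y').
Proof.
move=> di entA entC ctF ctH FH y y' yy'.
set A1 := split_ent (split_ent A) in yy' *.
set C1 := split_ent (split_ent C) in FH *.
have entA1 : entourage A1 by do 2 apply: entourage_split_ent.
have entC1 : entourage C1 by do 2 apply: entourage_split_ent.
have [_ [x _ <-] [xy Fyx]] : exists2 z, range i z & A1 (z, y) /\ C1 (F y, F z).
  apply: (dense_nbhs di); apply: (@filterI _ (nbhs y)).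
  - by apply/nbhsP; exists (A1^-1)%relation => [|z /xsectionP].
  - exact: (cvg_entourage (ctF y)).
have [_ [x' _ <-] [y'x' Hx'y']] :
    exists2 z, range i z & A1 (y', z) /\ C1 (H z, H y').
  apply: (dense_nbhs di); apply: (@filterI _ (nbhs y')).
  - by apply/nbhsP; exists A1 => // z /xsectionP.
  - exact: (cvg_entourage (ctH y') (entourage_inv entC1)).
(* The chain [i x], [y], [y'], [i x'] has three [A1]-steps: the first two compose to a step of
   [split_ent A], and the third is enlarged to one. The chain through [F] and [H] below is treated
   alike. *)
have {}FH : C1 (F (i x), H (i x')).
  apply: FH; apply: (entourage_split y') => //.
  - exact: (entourage_split y).
  - by apply: split_ent_subset => //; exact: entourage_split_ent.
apply: (entourage_split (H (i x'))) => //.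
- exact: (entourage_split (F (i x))).
- by apply: split_ent_subset => //; exact: entourage_split_ent.
Qed.

(** As [U] is the initial uniformity along [i], its topology is the initial topology along [i]. *)
Lemma is_completion_open (X Y : topologicalType) (U : uniformity X)
    (V : uniformity Y) (i : X -> Y) (O : set X) :
  is_completion (i : uspace U -> uspace V) -> open O ->
  exists2 O' : set Y, open O' & O = i @^-1` O'.
Proof.
move=> [_ entE _ _ _] oO.
suff : @open (initial_topology (i : uspace U -> uspace V)) O.
  by move=> [O' oO' <-]; exists O'.
move: oO; rewrite !openE => oO x /oO; rewrite /interior.
rewrite -[X in X -> _]/(nbhs (x : uspace U) O).
rewrite -[X in _ -> X]/(nbhs (x : initial_topology (_ : _ -> uspace V)) O).
by rewrite -!nbhs_entourageE entE.
Qed.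


Lemma is_completion_entourage (X Y : topologicalType) (U : uniformity X)
    (V : uniformity Y) (i : X -> Y) (W : set (uspace U * uspace U)) :
  is_completion (i : uspace U -> uspace V) ->
  entourage W ->
  exists2 A : set (uspace V * uspace V), entourage A &
    forall x x', A (i x, i x') -> W (x, x').
Proof.
move=> [_ -> _ _ _] [A entA AW]; exists A => // x x' Axx'.
exact: (AW (x, x')).
Qed.

Lemma is_completion_preimage (X Y : topologicalType) (U : uniformity X)
    (V : uniformity Y) (i : X -> Y) (A : set (uspace V * uspace V)) :
  is_completion (i : uspace U -> uspace V) ->
  entourage A ->
  @entourage (uspace U) [set p | A (i p.1, i p.2)].
Proof. by move=> [_ -> _ _ _] entA; exists A. Qed.

(** Entourage form of the condition on covers, applied to the cover by sections of a symmetric half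
    of [E]. Two [W]-close points lie in one member [B] of [v], and all translates of [B] by [O] lie
    in one section, so [act g x] and [act h x'] are both close to its centre [z]. *)
Lemma equiuniformity_small (G : groupType) (tau : topology G)
    (X : topologicalType) (act : G -> X -> X) (U : uniformity X)
    (E : set (uspace U * uspace U)) :
  equiuniformity tau act U -> entourage E ->
  exists O : set (Defs.space tau), exists W : set (uspace U * uspace U),
    [/\ nbhs (1%g : Defs.space tau) O, entourage W &
      forall g h x x', O g -> O h -> W (x, x') -> E (act g x, act h x')].
Proof.
move=> [_ equi] entE.
pose D : set (uspace U * uspace U) := split_ent E.
have entD : entourage D by exact: entourage_split_ent.
pose D' := (D `&` D^-1)%relation.
have entD' : entourage D' by exact: entourage_invI.
have [|O [v [O1 [W entW Wv] Ov]]] := equi (range (xsection D')).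
  by exists D' => // x; exists (xsection D' x) => //; exists x.
exists O, W; split => // g h x x' Og Oh Wxx'.
have [B vB WB] := Wv x.
have [|_ [z _ <-] sub] := Ov [set act g x | g in O & x in B].
  by exists B.
have Bx : B x by apply/WB/xsectionP; exact: entourage_refl.
have Bx' : B x' by apply/WB/xsectionP.
have /xsectionP[_ zg] : xsection D' z (act g x).
  by apply: sub; exists g => //; exists x.
have /xsectionP[zh _] : xsection D' z (act h x').
  by apply: sub; exists h => //; exists x'.
exact: (@entourage_split (uspace U) z).
Qed.

(** Both conditions follow one route: an entourage of [Y] is restricted to [X], the condition on [U]
    is used there, the entourage obtained is induced by some [A] on [Y], and density carries the
    estimate from [X] to [Y]. *)
Lemma extension_equiuniformity (G : groupType) (tau : topology G)
    (X : topologicalType) (act : G -> X -> X) (Y : topologicalType)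
    (actY : G -> Y -> Y) (i : X -> Y) (U : uniformity X) (V : uniformity Y) :
  equiuniformity tau act U ->
  is_completion (i : uspace U -> uspace V) ->
  continuous_action tau actY ->
  (forall g x, i (act g x) = actY g (i x)) ->
  equiuniformity tau actY V.
Proof.
move=> equi compl cactY iact.
have [_ _ di _ _] := compl.
have ctY g : continuous (actY g : uspace V -> uspace V).
  exact: continuous_action_continuous cactY.
split.
  move=> g C entC.
  have entC1 := is_completion_preimage compl
    (entourage_split_ent (entourage_split_ent entC)).
  have [A entA AC] := is_completion_entourage compl (equi.1 g _ entC1).
  apply: (filterS _ (entourage_split_ent (entourage_split_ent entA))).
  move=> [y y'] /=; apply: (entourage_dense_extension di entA entC) => //.
  by move=> x x' /AC /=; rewrite !iact.
move=> u [C entC Cu].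
have entC1 := is_completion_preimage compl
  (entourage_split_ent (entourage_split_ent entC)).
have [O [W [O1 entW OW]]] := equiuniformity_small equi entC1.
have [A entA AW] := is_completion_entourage compl entW.
pose A1 : set (uspace V * uspace V) := split_ent (split_ent A).
have entA1 : entourage A1 by do 2 apply: entourage_split_ent.
exists O, (range (xsection A1)); split => //.
  by exists A1 => // y; exists (xsection A1 y) => //; exists y.
move=> _ [_ [y _ <-] <-].
have [B uB CB] := Cu y; exists B => // _ [g Og [y' /xsectionP yy' <-]].
(* With [y] written as [1] acting on [y], the density lemma applies to the maps [actY 1] and
   [actY g]; both [1] and [g] lie in [O]. *)
apply/CB/xsectionP; rewrite -[y in C (y, _)](cactY.1.1).
apply: (entourage_dense_extension di entA entC) => //.
move=> x x' /AW; rewrite -!iact; apply: OW => //.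
exact: nbhs_singleton O1.
Qed.

Theorem lemma2p17 (G : groupType) (tau : topology G)
    (X : topologicalType) (act : G -> X -> X)
    (Y : topologicalType) (actY : G -> Y -> Y) (i : X -> Y) :
  topological_group tau ->
  taup_representable tau act ->
  G_extension tau act actY i ->
  taup_representable tau actY /\
  (admissible_group_topology actY tau /\
   forall sigma : topology G, admissible_group_topology actY sigma ->
     opens tau `<=` opens sigma).
Proof.
move=> [gtau _] [[_ eff _] tauE _] [U [V [equi compl cactY iact]]].
have effY : effective actY.
  have [inj _ _ _ _] := compl.
  by move=> g gY; apply: eff => x; apply: inj; rewrite iact.
have tau_min sigma : continuous_action sigma actY ->
    taup_opens actY `<=` opens sigma.
  move=> cact; apply: taup_opens_min => y O.
  exact: continuous_action_orbit_open cact.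
have tauYE : opens tau = taup_opens actY.
  apply/seteqP; split; last exact: tau_min.
  (* [tau_p] of the action on [Y], repackaged as a [topology]. *)
  pose sigma : topology G := @Topology G (taup_opens actY)
    (@openT (taup_space actY)) (@openI (taup_space actY))
    (fun I f fo => @bigcup_open (taup_space actY) I setT f (fun j _ => fo j)).
  rewrite tauE; apply: (@taup_opens_min _ _ _ sigma) => x O oO.
  have [O' oO' ->] := is_completion_open compl oO.
  (* Equivariance of [i] turns a subbasic set at [x] into one at [i x]. *)
  have -> : [set g | (i @^-1` O') (act g x)] = [set g | O' (actY g (i x))].
    by apply/seteqP; split => g /=; rewrite iact.
  exact: taup_opens_subbase.
split; first split => //.
- split => //; first by case: cactY.
  by move=> g; exact: continuous_action_homeomorphism cactY.
- split; last first.
    by exists V; exact: extension_equiuniformity equi compl cactY iact.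
  (* [Y] is Tychonoff: the Hausdorff property is part of being a completion, and complete regularity
     comes from [V]. *)
  split => //; split; first by case: compl.
  exact: uniformity_completely_regular V.
split; first by split.
by move=> sigma [_ cact]; rewrite tauYE; exact: tau_min.
Qed.
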